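(* For every integer $n > 1$, stit logic does not have the Strong $n$-Craig Interpolation Property $(SCIP)_n$; that is, it is not the case that for every set of propositional variables $V$ and all $A, B \in \mathcal{L}^{\{1,\ldots,n\}}_V$ with $\vdash A \to B$ there exists $C \in \mathcal{L}^{Ag(A)\cap Ag(B)}_{|A|\cap|B|}$ with both $\vdash A \to C$ and $\vdash C \to B$.
   Context: For a finite set $Ag$ of agent indices (possibly empty) and a set $V$ of propositional variables, $\mathcal{L}^{Ag}_V$ is the set of stit formulas given by $A ::= p \mid A \to A \mid \bot \mid \Box A \mid [j]A$ with $p \in V$, $j \in Ag$ (other Boolean connectives defined as usual; $\Diamond A := \neg\Box\neg A$). $\vdash A$ means derivability in the axiom system $\mathbb{S}$ with axioms: all classical propositional tautologies; S5 axioms for $\Box$ and for each $[j]$; $\Box A \to [j]A$; and $(\Diamond[j_1]A_1 \wedge\dots\wedge \Diamond[j_k]A_k) \to \Diamond([j_1]A_1\wedge\dots\wedge[j_k]A_k)$ for pairwise distinct $j_1,\dots,j_k$; rules: modus ponens and necessitation for $\Box$. For a formula $A$, $|A|$ is the set of propositional variables occurring in $A$ and $Ag(A)$ the set of agent indices occurring in $A$. *)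

(* Defs.v *)
From mathcomp Require Import all_boot.

Set Implicit Arguments.
Unset Strict Implicit.
Unset Printing Implicit Defensive.

(* The type [formula Ag V] is the language L^Ag_V. *)
Inductive formula (Ag : finType) (V : Type) : Type :=
| Var of V
| Imp of formula Ag V & formula Ag V
| Bot
| Box of formula Ag V
| Stit of Ag & formula Ag V.

Arguments Var {Ag V} _.
Arguments Imp {Ag V} _ _.
Arguments Bot {Ag V}.
Arguments Box {Ag V} _.
Arguments Stit {Ag V} _ _.

Definition Neg (Ag : finType) (V : Type) (A : formula Ag V) : formula Ag V :=
  Imp A Bot.

Definition And (Ag : finType) (V : Type) (A B : formula Ag V) : formula Ag V :=
  Neg (Imp A (Neg B)).

Definition Diamond (Ag : finType) (V : Type) (A : formula Ag V) :
    formula Ag V :=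
  Neg (Box (Neg A)).

Fixpoint Conj (Ag : finType) (V : Type) (s : seq (formula Ag V)) :
    formula Ag V :=
  match s with
  | [::] => Neg Bot
  | [:: A] => A
  | A :: s' => And A (Conj s')
  end.

Fixpoint vars (Ag : finType) (V : Type) (A : formula Ag V) : V -> Prop :=
  match A with
  | Var p => fun q => q = p
  | Imp B C => fun q => vars B q \/ vars C q
  | Bot => fun _ => False
  | Box B => vars B
  | Stit _ B => vars B
  end.

Fixpoint agents (Ag : finType) (V : Type) (A : formula Ag V) : {set Ag} :=
  match A with
  | Var _ => set0
  | Imp B C => agents B :|: agents C
  | Bot => set0
  | Box B => agents B
  | Stit j B => j |: agents B
  end.

(* The sublanguage L^G_W, for G a set of agents in Ag and W a set of variables
   in V. *)
Fixpoint in_lang (Ag : finType) (V : Type) (G : {set Ag}) (W : V -> Prop)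
    (A : formula Ag V) : Prop :=
  match A with
  | Var p => W p
  | Imp B C => in_lang G W B /\ in_lang G W C
  | Bot => True
  | Box B => in_lang G W B
  | Stit j B => j \in G /\ in_lang G W B
  end.

(* Boolean evaluation in which variables and modal formulas are atoms, with
   truth values given by v. *)
Fixpoint prop_eval (Ag : finType) (V : Type) (v : formula Ag V -> bool)
    (A : formula Ag V) : bool :=
  match A with
  | Imp B C => prop_eval v B ==> prop_eval v C
  | Bot => false
  | _ => v A
  end.

Definition tautology (Ag : finType) (V : Type) (A : formula Ag V) : Prop :=
  forall v : formula Ag V -> bool, prop_eval v A.

Inductive S5_axiom (Ag : finType) (V : Type)
    (box : formula Ag V -> formula Ag V) : formula Ag V -> Prop :=
| S5_K A B : S5_axiom box (Imp (box (Imp A B)) (Imp (box A) (box B)))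
| S5_T A : S5_axiom box (Imp (box A) A)
| S5_4 A : S5_axiom box (Imp (box A) (box (box A)))
| S5_5 A : S5_axiom box (Imp (Neg (box A)) (box (Neg (box A)))).

(* In [ax_indep], s lists the pairs (j_1, A_1), ..., (j_k, A_k). *)
Inductive derivable (Ag : finType) (V : Type) : formula Ag V -> Prop :=
| ax_taut A : tautology A -> derivable A
| ax_Box A : S5_axiom Box A -> derivable A
| ax_Stit j A : S5_axiom (Stit j) A -> derivable A
| ax_Box_Stit j A : derivable (Imp (Box A) (Stit j A))
| ax_indep (s : seq (Ag * formula Ag V)) :
    0 < size s -> uniq [seq x.1 | x <- s] ->
    derivable (Imp (Conj [seq Diamond (Stit x.1 x.2) | x <- s])
                   (Diamond (Conj [seq Stit x.1 x.2 | x <- s])))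
| rule_MP A B : derivable (Imp A B) -> derivable A -> derivable B
| rule_Nec A : derivable A -> derivable (Box A).

(* 'I_n stands for the set {1, ..., n} of agent indices, i : 'I_n being the
   agent i + 1. *)
Definition SCIP (n : nat) : Prop :=
  forall (V : Type) (A B : formula 'I_n V),
    derivable (Imp A B) ->
    exists C : formula 'I_n V,
      [/\ in_lang (agents A :&: agents B) (fun p => vars A p /\ vars B p) C,
          derivable (Imp A C)
        & derivable (Imp C B)].

(* Main.v *)
Require Import Defs.
From mathcomp Require Import all_boot.

Set Implicit Arguments.
Unset Strict Implicit.
Unset Printing Implicit Defensive.

(** By independence of agents, [<>[1]p -> ~ <>[2]~p] is derivable. The antecedent
    and the consequent share no agent, so an interpolant may only use [Box] and
    [p]. Consider a single moment with two histories, [p] holding at exactly one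
    of them, and let one agent [a] have the two singletons as choices while all
    other agents have only the vacuous choice. A formula without agents has the
    same value for [a = 1] and for [a = 2], but the antecedent holds for [a = 1]
    and the consequent fails for [a = 2]. *)

(* The histories are the booleans; every variable holds at [true] only. *)
Fixpoint eval (Ag : finType) (V : Type) (a : Ag) (A : formula Ag V)
    (w : bool) : bool :=
  match A with
  | Var _ => w
  | Imp B C => eval a B w ==> eval a C w
  | Bot => false
  | Box B => eval a B true && eval a B false
  | Stit j B => if j == a then eval a B w else eval a B true && eval a B false
  end.

Section Soundness.

Variables (Ag : finType) (V : Type) (a : Ag).
Implicit Types (A B : formula Ag V) (s : seq (Ag * formula Ag V)) (w : bool).

Lemma eval_Imp A B w : eval a (Imp A B) w = (eval a A w ==> eval a B w).
Proof. by []. Qed.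

Lemma eval_And A B w : eval a (And A B) w = eval a A w && eval a B w.
Proof. by rewrite /=; case: (eval a A w); case: (eval a B w). Qed.

Lemma eval_Diamond A w : eval a (Diamond A) w = eval a A true || eval a A false.
Proof. by rewrite /=; case: (eval a A true); case: (eval a A false). Qed.

Lemma eval_Conj (r : seq (formula Ag V)) w :
  eval a (Conj r) w = all (fun A => eval a A w) r.
Proof.
elim: r => [|A [|B r] IHr] //; first by rewrite /= andbT.
by rewrite [Conj _]/(And A (Conj (B :: r))) eval_And IHr.
Qed.

Lemma eval_prop_eval A w : prop_eval (fun B => eval a B w) A = eval a A w.
Proof. by elim: A => //= B -> C ->. Qed.

(** An agent other than [a] has only the vacuous choice, so [Stit j] acts as [Box] and its value is
    the same at both histories. *)
Lemma eval_Diamond_Stit_neq j A w u :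
  j != a -> eval a (Diamond (Stit j A)) w -> eval a (Stit j A) u.
Proof. by rewrite eval_Diamond /= => /negPf ->; rewrite orbb. Qed.

Lemma eval_indep_notin s w u :
    a \notin [seq x.1 | x <- s] ->
    all (fun x => eval a (Diamond (Stit x.1 x.2)) w) s ->
  all (fun x => eval a (Stit x.1 x.2) u) s.
Proof.
elim: s => // -[j A] s IHs.
rewrite map_cons inE negb_or eq_sym => /andP[ja nas] /andP[dA ds].
by apply/andP; split; [apply: eval_Diamond_Stit_neq dA | apply: IHs].
Qed.

(** By uniqueness at most one pair concerns [a]. The diamond of that pair supplies the history [u];
    the other conjuncts hold at every history as soon as they are possible. *)
Lemma eval_indep s w :
    uniq [seq x.1 | x <- s] ->
    all (fun x => eval a (Diamond (Stit x.1 x.2)) w) s ->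
  exists u, all (fun x => eval a (Stit x.1 x.2) u) s.
Proof.
elim: s => [|[j A] s IHs]; first by exists w.
rewrite map_cons cons_uniq => /andP[njs us] /andP[dA ds].
have [ja|ja] := eqVneq j a; last first.
  have [u hu] := IHs us ds.
  by exists u; apply/andP; split; first exact: eval_Diamond_Stit_neq dA.
have [u hu] : exists u, eval a (Stit j A) u.
  by move: dA; rewrite eval_Diamond => /orP[] ?; [exists true | exists false].
exists u; apply/andP; split=> //.
by apply: eval_indep_notin ds; rewrite -ja.
Qed.

(** The two cases are the universal relation and the identity on histories, both equivalence
    relations; each modality of the model is one of them. *)
Lemma S5_axiom_eval (box : formula Ag V -> formula Ag V) A w :
    (forall B u, eval a (box B) u = eval a B true && eval a B false) \/
    (forall B u, eval a (box B) u = eval a B u) ->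
  S5_axiom box A -> eval a A w.
Proof.
by case=> E [] *; rewrite /= !E /= ?E //=; case: w;
   do ?[case: (eval _ _ true)]; do ?[case: (eval _ _ false)].
Qed.

Lemma derivable_eval A : derivable A -> forall w, eval a A w.
Proof.
elim=> {A} [A tA|A hA|j A hA|j A|s _ us|A B _ IHAB _ IHA|A _ IHA] w.
- by rewrite -eval_prop_eval; apply: tA.
- by apply: S5_axiom_eval hA; left.
- by apply: S5_axiom_eval hA; have [ja|/negPf ja] := eqVneq j a; [right | left];
     move=> B u /=; rewrite ?ja ?eqxx.
- rewrite /=; case: ifP => _; last exact: implybb.
  by apply/implyP=> /andP[]; case: w.
- rewrite eval_Imp eval_Conj all_map; apply/implyP=> /(eval_indep us)[u hu].
  rewrite eval_Diamond !eval_Conj !all_map.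
  by apply/orP; case: u hu; [left | right].
- exact: implyP (IHAB w) (IHA w).
- by rewrite /= !IHA.
Qed.

End Soundness.

(** Every agent in [G] differs from both [a] and [b], hence is read as [Box] in either model. *)
Lemma eval_in_lang (Ag : finType) (V : Type) (a b : Ag) (G : {set Ag})
    (W : V -> Prop) (C : formula Ag V) :
  a \notin G -> b \notin G -> in_lang G W C -> eval a C =1 eval b C.
Proof.
move=> aG bG; elim: C => //= [B IHB C IHC|B IHB|j B IHB].
- by case=> /IHB hB /IHC hC w; rewrite hB hC.
- by move=> /IHB hB _; rewrite !hB.
- case=> jG /IHB hB w; rewrite !hB.
  by rewrite (negPf (memPn aG _ jG)) (negPf (memPn bG _ jG)).
Qed.

Lemma derivable_Stit_disjoint (Ag : finType) (V : Type) (i j : Ag)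
    (A : formula Ag V) :
  i != j ->
  derivable (Imp (Diamond (Stit i A)) (Neg (Diamond (Stit j (Neg A))))).
Proof.
move=> ij.
have indep := @ax_indep Ag V [:: (i, A); (j, Neg A)] isT.
rewrite /= inE ij in indep; move/(_ isT) in indep.
set X := And _ _ in indep; set Y := And _ _ in indep.
(* The T axioms extract both [A] and [Neg A] from [Y]. Necessitation of [Neg Y] then contradicts the
   conclusion [Diamond Y] of [indep]. *)
have nY : derivable (Neg Y).
  have Ti := ax_Stit (S5_T (Stit i) A).
  have Tj := ax_Stit (S5_T (Stit j) (Neg A)).
  apply: rule_MP Tj; apply: rule_MP Ti; apply: ax_taut => v /=.
  by case: (v (Stit i A)); case: (v (Stit j _)); case: (prop_eval v A).
apply: rule_MP (rule_Nec nY); apply: rule_MP indep.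
apply: ax_taut => v; rewrite /= -/Y.
by case: (v (Box (Neg Y))); case: (v (Box (Neg (Stit i A))));
   case: (v (Box (Neg (Stit j (Neg A))))).
Qed.

Theorem theorem5 (n : nat) (hn : 1 < n) : ~ SCIP n.
Proof.
pose i : 'I_n := Ordinal (ltnW hn); pose j : 'I_n := Ordinal hn.
have ij : i != j by [].
move=> /(_ unit _ _ (derivable_Stit_disjoint (Var tt) ij))[C [LC AC CB]].
have hij : eval i C =1 eval j C.
  by apply: eval_in_lang LC; rewrite /= !inE !orbF ?eqxx.
have hC : eval i C true.
  (* With [i] as the deciding agent, the history [true] witnesses the antecedent. *)
  by apply: implyP (derivable_eval i AC true) _; rewrite /= ?eqxx.
rewrite hij in hC.
(* With [j] as the deciding agent, the history [false] witnesses the diamond that the consequent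
   denies. *)
by have := implyP (derivable_eval j CB true) hC; rewrite /= ?eqxx.
Qed.
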